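(* Let $\mathcal B$ be a Krull–Schmidt exact category with enough projectives and enough injectives, let $\mathcal A$ be an abelian category and let $F:\mathcal B\to\mathcal A$ be a half exact functor satisfying $F(\mathcal P)=0$ and $F(\mathcal I)=0$. Then for any short exact sequence $A\stackrel{f}{\rightarrowtail}B\stackrel{g}{\twoheadrightarrow}C$ in $\mathcal B$ there exist morphisms $h:C\to\Omega^-A$ and $h':\Omega C\to A$ such that the sequence $$\cdots\xrightarrow{F(\Omega h')}F(\Omega A)\xrightarrow{F(\Omega f)}F(\Omega B)\xrightarrow{F(\Omega g)}F(\Omega C)\xrightarrow{F(h')}F(A)\xrightarrow{F(f)}F(B)\xrightarrow{F(g)}F(C)\xrightarrow{F(h)}F(\Omega^-A)\xrightarrow{F(\Omega^-f)}F(\Omega^-B)\xrightarrow{F(\Omega^-g)}F(\Omega^-C)\xrightarrow{F(\Omega^-h)}\cdots$$ is exact in $\mathcal A$. Moreover, these morphisms can be chosen so that the long exact sequence is natural: whenever $(a,b,c)$ is a morphism from a short exact sequence $A\stackrel{f}{\rightarrowtail}B\stackrel{g}{\twoheadrightarrow}C$ to a short exact sequence $A_1\stackrel{f_1}{\rightarrowtail}B_1\stackrel{g_1}{\twoheadrightarrow}C_1$ (i.e. $a:A\to A_1$, $b:B\to B_1$, $c:C\to C_1$ with $bf=f_1a$, $cg=g_1b$), with corresponding morphisms $h,h'$ and $h_1,h_1'$, the morphisms $$\ldots,\ F(\Omega c),\ F(a),\ F(b),\ F(c),\ F(\Omega^-a),\ \ldots$$ form a commutative diagram in $\mathcal A$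 from the long exact sequence of the first short exact sequence to that of the second.
   Context: Exact category is meant in the sense of Quillen; short exact sequences are written $A\rightarrowtail B\twoheadrightarrow C$. $\mathcal P$ and $\mathcal I$ denote the full subcategories of projective and injective objects of $\mathcal B$. A covariant functor $F:\mathcal B\to\mathcal A$ to an abelian category is half exact if for every short exact sequence $A\stackrel{f}{\rightarrowtail}B\stackrel{g}{\twoheadrightarrow}C$ in $\mathcal B$ the sequence $F(A)\xrightarrow{F(f)}F(B)\xrightarrow{F(g)}F(C)$ is exact. $\mathcal B/\mathcal P$ and $\mathcal B/\mathcal I$ are the ideal quotients (morphisms modulo those factoring through a projective, resp. injective, object). $\Omega:\mathcal B/\mathcal P\to\mathcal B/\mathcal P$ is the syzygy functor, defined via chosen short exact sequences $\Omega X\rightarrowtail P_X\twoheadrightarrow X$ with $P_X\in\mathcal P$, and $\Omega^-:\mathcal B/\mathcal I\to\mathcal B/\mathcal I$ is the cosyzygy functor, defined via chosen short exact sequences $X\rightarrowtail I^X\twoheadrightarrow\Omega^-X$ with $I^X\in\mathcal I$. Since $F(\mathcal P)=0$ and $F(\mathcal I)=0$, $F$ factors through $\mathcal B/\mathcal P$ and through $\mathcal B/\mathcal I$, so expressions such as $F(\Omega f)$ and $F(\Omega^-f)$ (and their iterates $F(\Omega^nf)$, $F((\Omega^-)^nf)$) are well defined. *)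

(* Defs.v *)
From HB Require Import structures.
From mathcomp Require Import all_boot all_algebra.
From mathcomp Require Import boolp.

Set Implicit Arguments.
Unset Strict Implicit.
Unset Printing Implicit Defensive.

Import GRing.Theory.
Local Open Scope ring_scope.
Local Open Scope quotient_scope.
#[local] Obligation Tactic := idtac.

Record preadditive := Preadditive {
  obj :> Type;
  mor : obj -> obj -> zmodType;
  idm : forall X, mor X X;
  mcomp : forall X Y Z, mor Y Z -> mor X Y -> mor X Z;
  mcompA : forall X Y Z T (h : mor Z T) (g : mor Y Z) (f : mor X Y),
    mcomp h (mcomp g f) = mcomp (mcomp h g) f;
  mcomp1f : forall X Y (f : mor X Y), mcomp (idm Y) f = f;
  mcompf1 : forall X Y (f : mor X Y), mcomp f (idm X) = f;
  mcompDl : forall X Y Z (g1 g2 : mor Y Z) (f : mor X Y),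
    mcomp (g1 + g2) f = mcomp g1 f + mcomp g2 f;
  mcompDr : forall X Y Z (g : mor Y Z) (f1 f2 : mor X Y),
    mcomp g (f1 + f2) = mcomp g f1 + mcomp g f2 }.

Arguments mor {p} X Y.
Arguments idm {p} X.
Arguments mcomp {p X Y Z} g f.

Notation "g \oc f" := (mcomp g f) (at level 40, left associativity).

Section Notions.
Variable C : preadditive.

Definition is_iso (X Y : C) (f : mor X Y) : Prop :=
  exists g : mor Y X, g \oc f = idm X /\ f \oc g = idm Y.

Definition is_mono (X Y : C) (f : mor X Y) : Prop :=
  forall T (u v : mor T X), f \oc u = f \oc v -> u = v.

Definition is_epi (X Y : C) (f : mor X Y) : Prop :=
  forall T (u v : mor Y T), u \oc f = v \oc f -> u = v.

(* Initial and terminal: existence of the two morphisms is automatic, the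
   hom-sets being groups. *)
Definition is_zero (X : C) : Prop :=
  (forall Y (f g : mor X Y), f = g) /\ (forall Y (f g : mor Y X), f = g).

Definition is_biproduct (X Y S : C) (i1 : mor X S) (i2 : mor Y S)
    (p1 : mor S X) (p2 : mor S Y) : Prop :=
  [/\ p1 \oc i1 = idm X, p2 \oc i2 = idm Y, p1 \oc i2 = 0, p2 \oc i1 = 0
    & i1 \oc p1 + i2 \oc p2 = idm S].

Definition is_direct_sum (n : nat) (X : 'I_n -> C) (S : C)
    (i : forall k, mor (X k) S) (p : forall k, mor S (X k)) : Prop :=
  [/\ forall k, p k \oc i k = idm (X k),
      forall j k, j != k -> p j \oc i k = 0
    & \sum_(k < n) i k \oc p k = idm S].

Definition additive_cat : Prop :=
  (exists O : C, is_zero O) /\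
  (forall X Y : C, exists (S : C) (i1 : mor X S) (i2 : mor Y S)
     (p1 : mor S X) (p2 : mor S Y), is_biproduct i1 i2 p1 p2).

Definition is_kernel (K X Y : C) (k : mor K X) (f : mor X Y) : Prop :=
  f \oc k = 0 /\
  forall T (t : mor T X), f \oc t = 0 -> exists! s : mor T K, k \oc s = t.

Definition is_cokernel (X Y Q : C) (q : mor Y Q) (f : mor X Y) : Prop :=
  q \oc f = 0 /\
  forall T (t : mor Y T), t \oc f = 0 -> exists! s : mor Q T, s \oc q = t.

(*   A --i--> B
     |a       |b
     A' -i'-> B'   *)
Definition is_pushout (A B A' B' : C) (i : mor A B) (a : mor A A')
    (i' : mor A' B') (b : mor B B') : Prop :=
  b \oc i = i' \oc a /\
  forall T (u : mor A' T) (v : mor B T), v \oc i = u \oc a ->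
    exists! w : mor B' T, w \oc i' = u /\ w \oc b = v.

(*   B' -p'-> C'
     |b       |c
     B --p--> X    *)
Definition is_pullback (B' C' B X : C) (p' : mor B' C') (b : mor B' B)
    (p : mor B X) (c : mor C' X) : Prop :=
  p \oc b = c \oc p' /\
  forall T (u : mor T C') (v : mor T B), p \oc v = c \oc u ->
    exists! w : mor T B', p' \oc w = u /\ b \oc w = v.

Definition abelian_cat : Prop :=
  additive_cat /\
  [/\ forall (X Y : C) (f : mor X Y), exists K (k : mor K X), is_kernel k f,
      forall (X Y : C) (f : mor X Y), exists Q (q : mor Y Q), is_cokernel q f,
      forall (X Y : C) (f : mor X Y), is_mono f ->
        exists Z (g : mor Y Z), is_kernel f g
    & forall (X Y : C) (f : mor X Y), is_epi f ->
        exists Z (g : mor Z X), is_cokernel f g].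

Definition is_image (I X Y : C) (m : mor I Y) (f : mor X Y) : Prop :=
  exists Q (q : mor Y Q), is_cokernel q f /\ is_kernel m q.

(* Exactness of X -> Y -> Z at Y: the image of f is the kernel of g. *)
Definition exact_at (X Y Z : C) (f : mor X Y) (g : mor Y Z) : Prop :=
  exists I (m : mor I Y), is_image m f /\ is_kernel m g.

(* The endomorphism ring of X is local: it is nonzero and the sum of two
   non-units is a non-unit. *)
Definition local_end (X : C) : Prop :=
  idm X <> 0 /\
  forall f g : mor X X, ~ is_iso f -> ~ is_iso g -> ~ is_iso (f + g).

Definition krull_schmidt : Prop :=
  forall S : C, exists (n : nat) (X : 'I_n -> C) (i : forall k, mor (X k) S)
    (p : forall k, mor S (X k)),
    is_direct_sum i p /\ forall k, local_end (X k).

End Notions.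

Arguments is_zero {C} X.

Record functor (C D : preadditive) := Functor {
  fobj :> C -> D;
  fmap : forall X Y : C, mor X Y -> mor (fobj X) (fobj Y);
  fmap1 : forall X, fmap (idm X) = idm (fobj X);
  fmap_comp : forall X Y Z (g : mor Y Z) (f : mor X Y),
    fmap (g \oc f) = fmap g \oc fmap f }.

Arguments fmap {C D} _ {X Y} _.

Definition functor_id (C : preadditive) : functor C C :=
  @Functor C C id (fun _ _ f => f) (fun=> erefl) (fun _ _ _ _ _ => erefl).

Program Definition functor_comp (C D E : preadditive) (G : functor D E)
    (F : functor C D) : functor C E :=
  @Functor C E (fun X => G (F X)) (fun _ _ f => fmap G (fmap F f)) _ _.
Next Obligation. by move=> C D E G F X /=; rewrite !fmap1. Qed.
Next Obligation. by move=> C D E G F X Y Z g f /=; rewrite !fmap_comp. Qed.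

(* G^(n+1) = G^n o G, so that G^(n+1) X is convertible to G^n (G X). *)
Fixpoint functor_iter (C : preadditive) (G : functor C C) (n : nat) :
    functor C C :=
  if n is m.+1 then functor_comp (functor_iter G m) G else functor_id C.

(* Quillen's notion, in the self-dual axiomatization of Keller and Buehler. *)
Record exactCat := ExactCat {
  ecat :> preadditive;
  ecat_additive : additive_cat ecat;
  conflation : forall A B C : ecat, mor A B -> mor B C -> Prop;
  inflation := fun (A B : ecat) (i : mor A B) =>
    exists C (p : mor B C), conflation i p;
  deflation := fun (B C : ecat) (p : mor B C) =>
    exists A (i : mor A B), conflation i p;
  conf_kernel : forall (A B C : ecat) (i : mor A B) (p : mor B C),
    conflation i p -> is_kernel i p;
  conf_cokernel : forall (A B C : ecat) (i : mor A B) (p : mor B C),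
    conflation i p -> is_cokernel p i;
  conf_iso : forall (A B C A' B' C' : ecat) (i : mor A B) (p : mor B C)
      (i' : mor A' B') (p' : mor B' C')
      (a : mor A A') (b : mor B B') (c : mor C C'),
    is_iso a -> is_iso b -> is_iso c ->
    b \oc i = i' \oc a -> c \oc p = p' \oc b ->
    conflation i p -> conflation i' p';
  infl_id : forall A : ecat, inflation (idm A);
  defl_id : forall A : ecat, deflation (idm A);
  infl_comp : forall (A B C : ecat) (j : mor B C) (i : mor A B),
    inflation j -> inflation i -> inflation (j \oc i);
  defl_comp : forall (A B C : ecat) (q : mor B C) (p : mor A B),
    deflation q -> deflation p -> deflation (q \oc p);
  infl_pushout : forall (A B A' : ecat) (i : mor A B) (a : mor A A'),
    inflation i ->
    exists (B' : ecat) (i' : mor A' B') (b : mor B B'),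
      is_pushout i a i' b /\ inflation i';
  defl_pullback : forall (B X C' : ecat) (p : mor B X) (c : mor C' X),
    deflation p ->
    exists (B' : ecat) (p' : mor B' C') (b : mor B' B),
      is_pullback p' b p c /\ deflation p' }.

Arguments conflation {e A B C} _ _.
Arguments inflation {e A B} _.
Arguments deflation {e B C} _.

(* Short exact sequences A >-> B ->> C. *)
Record ses (E : exactCat) := Ses {
  sesA : E;
  sesB : E;
  sesC : E;
  sesf : mor sesA sesB;
  sesg : mor sesB sesC;
  ses_conf : conflation sesf sesg }.

Section Projectives.
Variable E : exactCat.

Definition projective_obj (P : E) : Prop :=
  forall (Y Z : E) (p : mor Y Z), deflation p ->
  forall f : mor P Z, exists u : mor P Y, p \oc u = f.

Definition injective_obj (I : E) : Prop :=
  forall (X Y : E) (i : mor X Y), inflation i ->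
  forall f : mor X I, exists u : mor Y I, u \oc i = f.

Definition enough_projectives : Prop :=
  forall X : E, exists (K P : E) (i : mor K P) (p : mor P X),
    projective_obj P /\ conflation i p.

Definition enough_injectives : Prop :=
  forall X : E, exists (I K : E) (i : mor X I) (p : mor I K),
    injective_obj I /\ conflation i p.

(* A choice of Omega X >-> P_X ->> X for every X. *)
Record syzygies := Syzygies {
  syz : E -> E;
  syzP : E -> E;
  syz_i : forall X, mor (syz X) (syzP X);
  syz_p : forall X, mor (syzP X) X;
  syz_proj : forall X, projective_obj (syzP X);
  syz_conf : forall X, conflation (syz_i X) (syz_p X) }.

(* A choice of X >-> I^X ->> Omega^- X for every X. *)
Record cosyzygies := Cosyzygies {
  cosyz : E -> E;
  cosyzI : E -> E;
  cosyz_i : forall X, mor X (cosyzI X);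
  cosyz_p : forall X, mor (cosyzI X) (cosyz X);
  cosyz_inj : forall X, injective_obj (cosyzI X);
  cosyz_conf : forall X, conflation (cosyz_i X) (cosyz_p X) }.

End Projectives.

Arguments syz_proj {E} s X {Y Z p} _ f : rename.
Arguments cosyz_inj {E} c X {X0 Y i} _ f : rename.
Arguments syz_conf {E} s X.
Arguments cosyz_conf {E} c X.

Definition half_exact (E : exactCat) (A : preadditive) (F : functor E A) : Prop :=
  forall (X Y Z : E) (f : mor X Y) (g : mor Y Z),
    conflation f g -> exact_at (fmap F f) (fmap F g).

Section PreadditiveTheory.
Variable C : preadditive.
Implicit Types X Y Z : C.

Lemma mcomp0f X Y Z (f : mor X Y) : (0 : mor Y Z) \oc f = 0.
Proof. by apply: (@addrI _ (0 \oc f)); rewrite -mcompDl !addr0. Qed.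

Lemma mcompf0 X Y Z (g : mor Y Z) : g \oc (0 : mor X Y) = 0.
Proof. by apply: (@addrI _ (g \oc 0)); rewrite -mcompDr !addr0. Qed.

Lemma mcompNl X Y Z (g : mor Y Z) (f : mor X Y) : (- g) \oc f = - (g \oc f).
Proof. by apply: (@addrI _ (g \oc f)); rewrite -mcompDl !subrr mcomp0f. Qed.

Lemma mcompNr X Y Z (g : mor Y Z) (f : mor X Y) : g \oc (- f) = - (g \oc f).
Proof. by apply: (@addrI _ (g \oc f)); rewrite -mcompDr !subrr mcompf0. Qed.

Lemma mcompBl X Y Z (g1 g2 : mor Y Z) (f : mor X Y) :
  (g1 - g2) \oc f = g1 \oc f - g2 \oc f.
Proof. by rewrite mcompDl mcompNl. Qed.

Lemma mcompBr X Y Z (g : mor Y Z) (f1 f2 : mor X Y) :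
  g \oc (f1 - f2) = g \oc f1 - g \oc f2.
Proof. by rewrite mcompDr mcompNr. Qed.

Lemma kernel_monic (X Y Z : C) (k : mor X Y) (f : mor Y Z) :
  is_kernel k f -> is_mono k.
Proof.
move=> [fk kP] T u v kuv.
have [|s [_ sU]] := kP _ (k \oc v); first by rewrite mcompA fk mcomp0f.
by rewrite -(sU u) // -(sU v).
Qed.

Lemma cokernel_epic (X Y Z : C) (q : mor Y Z) (f : mor X Y) :
  is_cokernel q f -> is_epi q.
Proof.
move=> [qf qP] T u v quv.
have [|s [_ sU]] := qP _ (v \oc q); first by rewrite -mcompA qf mcompf0.
by rewrite -(sU u) // -(sU v).
Qed.

End PreadditiveTheory.

(* A class of objects closed under finite direct sums: the morphisms that
   factor through it form an ideal. *)
Record sum_class (C : preadditive) := SumClass {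
  in_class :> C -> Prop;
  in_class0 : exists O, in_class O;
  in_classD : forall X Y, in_class X -> in_class Y ->
    exists (S : C) (i1 : mor X S) (i2 : mor Y S) (p1 : mor S X) (p2 : mor S Y),
      in_class S /\ is_biproduct i1 i2 p1 p2 }.

Definition factors_through (C : preadditive) (W : C -> Prop) (X Y : C)
    (f : mor X Y) : Prop :=
  exists (Z : C) (v : mor Z Y) (u : mor X Z), W Z /\ f = v \oc u.

Definition ideal (C : preadditive) (W : sum_class C) (X Y : C) :
    {pred mor X Y} := [pred f | `[< factors_through W f >]].
Arguments ideal {C} W X Y.

Section Ideal.
Variables (C : preadditive) (W : sum_class C).

Lemma idealP X Y (f : mor X Y) : reflect (factors_through W f) (f \in ideal W X Y).
Proof. exact: asboolP. Qed.

Lemma idealMl X Y Z (g : mor Y Z) (f : mor X Y) :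
  f \in ideal W X Y -> g \oc f \in ideal W X Z.
Proof.
move=> /idealP[T [v [u [WT ->]]]]; apply/idealP.
by exists T, (g \oc v), u; rewrite mcompA.
Qed.

Lemma idealMr X Y Z (g : mor Y Z) (f : mor X Y) :
  g \in ideal W Y Z -> g \oc f \in ideal W X Z.
Proof.
move=> /idealP[T [v [u [WT ->]]]]; apply/idealP.
by exists T, v, (u \oc f); rewrite mcompA.
Qed.

Lemma ideal_zmod_closed X Y : zmod_closed (ideal W X Y).
Proof.
split=> [|f g /idealP[Z [v [u [WZ ->]]]] /idealP[Z' [v' [u' [WZ' ->]]]]].
  have [O WO] := in_class0 W; apply/idealP.
  by exists O, 0, 0; rewrite mcomp0f.
have [S [i1 [i2 [p1 [p2 [WS [e1 e2 e12 e21 _]]]]]]] := in_classD WZ WZ'.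
apply/idealP; exists S, (v \oc p1 - v' \oc p2), (i1 \oc u + i2 \oc u').
split=> //; rewrite mcompBl !mcompDr -!mcompA.
rewrite !(mcompA p1) !(mcompA p2) e1 e2 e12 e21.
by rewrite !mcomp0f !mcomp1f !mcompf0 add0r addr0.
Qed.

HB.instance Definition _ X Y :=
  GRing.isZmodClosed.Build (mor X Y) (ideal W X Y) (ideal_zmod_closed X Y).

Definition qhom X Y : zmodType := Quotient.quot (ideal W X Y).

Definition qcls X Y (f : mor X Y) : qhom X Y := \pi_(qhom X Y) f.
Definition qrep X Y (q : qhom X Y) : mor X Y := repr q.

Lemma qrepK X Y (q : qhom X Y) : qcls (qrep q) = q.
Proof. exact: reprK. Qed.

Lemma qclsP X Y (f g : mor X Y) : qcls f = qcls g <-> factors_through W (f - g).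
Proof.
have E : (f - g \in ideal W X Y) = (qcls f == qcls g).
  exact: (Quotient.idealrBE (ideal W X Y)).
by split=> [/eqP|/idealP]; [rewrite -E => /idealP | rewrite E => /eqP].
Qed.

Lemma qclsD X Y (f g : mor X Y) : qcls (f + g) = qcls f + qcls g.
Proof. exact: (raddfD (\pi_(Quotient.quot (ideal W X Y)))). Qed.

Definition qcomp X Y Z (g : qhom Y Z) (f : qhom X Y) : qhom X Z :=
  qcls (qrep g \oc qrep f).

Lemma qcompE X Y Z (g : mor Y Z) (f : mor X Y) :
  qcomp (qcls g) (qcls f) = qcls (g \oc f).
Proof.
apply/qclsP; apply/idealP.
have -> : qrep (qcls g) \oc qrep (qcls f) - g \oc f =
  qrep (qcls g) \oc (qrep (qcls f) - f) + (qrep (qcls g) - g) \oc f.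
  by rewrite mcompBr mcompBl addrA subrK.
by apply: rpredD; [apply: idealMl | apply: idealMr]; apply/idealP/qclsP;
  rewrite qrepK.
Qed.

(* The quotient C / W; its objects are those of C. *)
Program Definition ideal_quotient : preadditive :=
  @Preadditive C qhom (fun X => qcls (idm X)) qcomp _ _ _ _ _.
Next Obligation.
move=> X Y Z T h g f; rewrite -(qrepK h) -(qrepK g) -(qrepK f).
by rewrite !qcompE mcompA.
Qed.
Next Obligation. by move=> X Y f; rewrite -(qrepK f) qcompE mcomp1f. Qed.
Next Obligation. by move=> X Y f; rewrite -(qrepK f) qcompE mcompf1. Qed.
Next Obligation.
move=> X Y Z g1 g2 f; rewrite -(qrepK g1) -(qrepK g2) -(qrepK f).
by rewrite -qclsD !qcompE -qclsD mcompDl.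
Qed.
Next Obligation.
move=> X Y Z g f1 f2; rewrite -(qrepK g) -(qrepK f1) -(qrepK f2).
by rewrite -qclsD !qcompE -qclsD mcompDr.
Qed.

End Ideal.

Arguments qcls {C} W {X Y} f.
Arguments qrep {C W X Y} q.

Section StableCategories.
Variable E : exactCat.

Lemma zero_projective (O : E) : is_zero O -> projective_obj O.
Proof. by move=> [OP _] Y Z p _ f; exists 0; apply: OP. Qed.

Lemma zero_injective (O : E) : is_zero O -> injective_obj O.
Proof. by move=> [_ OP] X Y i _ f; exists 0; apply: OP. Qed.

Program Definition proj_class : sum_class E := @SumClass E (@projective_obj E) _ _.
Next Obligation.
by have [[O OP] _] := ecat_additive E; exists O; apply: zero_projective.
Qed.
Next Obligation.
move=> X Y PX PY; have [_ /(_ X Y)] := ecat_additive E.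
move=> [S [i1 [i2 [p1 [p2 S_X_Y]]]]]; exists S, i1, i2, p1, p2; split=> //.
have [_ _ _ _ S1] := S_X_Y => T Z q dq f.
have [u1 e1] := PX _ _ _ dq (f \oc i1); have [u2 e2] := PY _ _ _ dq (f \oc i2).
exists (u1 \oc p1 + u2 \oc p2).
by rewrite mcompDr !mcompA e1 e2 -!mcompA -mcompDr S1 mcompf1.
Qed.

Program Definition inj_class : sum_class E := @SumClass E (@injective_obj E) _ _.
Next Obligation.
by have [[O OP] _] := ecat_additive E; exists O; apply: zero_injective.
Qed.
Next Obligation.
move=> X Y IX IY; have [_ /(_ X Y)] := ecat_additive E.
move=> [S [i1 [i2 [p1 [p2 S_X_Y]]]]]; exists S, i1, i2, p1, p2; split=> //.
have [_ _ _ _ S1] := S_X_Y => T Z j ij f.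
have [u1 e1] := IX _ _ _ ij (p1 \oc f); have [u2 e2] := IY _ _ _ ij (p2 \oc f).
exists (i1 \oc u1 + i2 \oc u2).
by rewrite mcompDl -!mcompA e1 e2 !mcompA -mcompDl S1 mcomp1f.
Qed.

Definition stableP : preadditive := ideal_quotient proj_class.
Definition stableI : preadditive := ideal_quotient inj_class.

End StableCategories.

Section Syzygy.
Variables (E : exactCat) (O : syzygies E).

(* f' is induced on syzygies by a lift of f to the chosen projectives. *)
Definition syz_lift (X Y : E) (f : mor X Y) (f' : mor (syz O X) (syz O Y)) : Prop :=
  exists p : mor (syzP O X) (syzP O Y),
    syz_p O Y \oc p = f \oc syz_p O X /\ p \oc syz_i O X = syz_i O Y \oc f'.

Lemma syz_lift_ex (X Y : E) (f : mor X Y) : exists f', syz_lift f f'.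
Proof.
have dY : deflation (syz_p O Y) by exists (syz O Y), (syz_i O Y); apply: syz_conf.
have [p pE] := syz_proj O X dY (f \oc syz_p O X).
have [pi0 _] := conf_kernel (syz_conf O X).
have [_ /(_ _ (p \oc syz_i O X))] := conf_kernel (syz_conf O Y).
case; first by rewrite mcompA pE -mcompA pi0 mcompf0.
by move=> f' [f'E _]; exists f', p.
Qed.

Lemma syz_lift_unique (X Y : E) (f g : mor X Y) f' g' :
  qcls (proj_class E) f = qcls (proj_class E) g -> syz_lift f f' -> syz_lift g g' ->
  qcls (proj_class E) f' = qcls (proj_class E) g'.
Proof.
move=> /qclsP[Q [v [u [PQ fgE]]]] [p [pE f'E]] [r [rE g'E]].
have dY : deflation (syz_p O Y) by exists (syz O Y), (syz_i O Y); apply: syz_conf.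
have [w wE] := PQ _ _ _ dY v.
have [pi0 _] := conf_kernel (syz_conf O X).
have KY := conf_kernel (syz_conf O Y).
have [_ /(_ _ (p - r - w \oc (u \oc syz_p O X)))] := KY.
case.
  by rewrite !mcompBr pE rE mcompA wE mcompA -fgE mcompBl subrr.
move=> s [sE _]; apply/qclsP.
exists (syzP O X), s, (syz_i O X); split; first exact: syz_proj.
apply: (kernel_monic KY).
by rewrite mcompA sE mcompBr -f'E -g'E !mcompBl -!mcompA pi0 !mcompf0 subr0.
Qed.

Definition syz_map (X Y : E) (q : @mor (stableP E) X Y) :
    @mor (stableP E) (syz O X) (syz O Y) :=
  qcls (proj_class E) (sval (cid (syz_lift_ex (qrep q)))).

Lemma syz_mapE (X Y : E) (f : mor X Y) f' :
  syz_lift f f' -> syz_map (qcls _ f) = qcls _ f'.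
Proof.
rewrite /syz_map; case: cid => g' /= Hg' Hf'.
by apply: syz_lift_unique Hg' Hf'; rewrite qrepK.
Qed.

Program Definition Omega : functor (stableP E) (stableP E) :=
  @Functor (stableP E) (stableP E) (syz O) syz_map _ _.
Next Obligation.
move=> X; apply: syz_mapE; exists (idm _).
by rewrite !mcomp1f !mcompf1.
Qed.
Next Obligation.
move=> X Y Z g f; rewrite -(qrepK g) -(qrepK f) [X in syz_map X]qcompE.
have [g' Hg] := syz_lift_ex (qrep g); have [f' Hf] := syz_lift_ex (qrep f).
rewrite (syz_mapE Hg) (syz_mapE Hf) [RHS]qcompE.
apply: syz_mapE; have [p [p1 p2]] := Hg; have [r [r1 r2]] := Hf.
exists (p \oc r); split; first by rewrite mcompA p1 -mcompA r1 mcompA.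
by rewrite -mcompA r2 mcompA p2 mcompA.
Qed.

End Syzygy.

Section Cosyzygy.
Variables (E : exactCat) (O : cosyzygies E).

(* f' is induced on cosyzygies by an extension of f to the chosen injectives. *)
Definition cosyz_lift (X Y : E) (f : mor X Y)
    (f' : mor (cosyz O X) (cosyz O Y)) : Prop :=
  exists p : mor (cosyzI O X) (cosyzI O Y),
    p \oc cosyz_i O X = cosyz_i O Y \oc f /\ cosyz_p O Y \oc p = f' \oc cosyz_p O X.

Lemma cosyz_lift_ex (X Y : E) (f : mor X Y) : exists f', cosyz_lift f f'.
Proof.
have iX : inflation (cosyz_i O X).
  by exists (cosyz O X), (cosyz_p O X); apply: cosyz_conf.
have [p pE] := cosyz_inj O Y iX (cosyz_i O Y \oc f).
have [pi0 _] := conf_cokernel (cosyz_conf O Y).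
have [_ /(_ _ (cosyz_p O Y \oc p))] := conf_cokernel (cosyz_conf O X).
case; first by rewrite -mcompA pE mcompA pi0 mcomp0f.
by move=> f' [f'E _]; exists f', p.
Qed.

Lemma cosyz_lift_unique (X Y : E) (f g : mor X Y) f' g' :
  qcls (inj_class E) f = qcls (inj_class E) g ->
  cosyz_lift f f' -> cosyz_lift g g' ->
  qcls (inj_class E) f' = qcls (inj_class E) g'.
Proof.
move=> /qclsP[Q [v [u [IQ fgE]]]] [p [pE f'E]] [r [rE g'E]].
have iX : inflation (cosyz_i O X).
  by exists (cosyz O X), (cosyz_p O X); apply: cosyz_conf.
have [w wE] := IQ _ _ _ iX u.
have [pi0 _] := conf_cokernel (cosyz_conf O Y).
have KX := conf_cokernel (cosyz_conf O X).
have [_ /(_ _ (p - r - (cosyz_i O Y \oc v) \oc w))] := KX.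
case.
  by rewrite !mcompBl pE rE -!mcompA wE -fgE mcompBr subrr.
move=> s [sE _]; apply/qclsP.
exists (cosyzI O Y), (cosyz_p O Y), s; split; first exact: cosyz_inj.
apply: (cokernel_epic KX).
by rewrite -mcompA sE mcompBl -f'E -g'E !mcompBr !mcompA pi0 !mcomp0f subr0.
Qed.

Definition cosyz_map (X Y : E) (q : @mor (stableI E) X Y) :
    @mor (stableI E) (cosyz O X) (cosyz O Y) :=
  qcls (inj_class E) (sval (cid (cosyz_lift_ex (qrep q)))).

Lemma cosyz_mapE (X Y : E) (f : mor X Y) f' :
  cosyz_lift f f' -> cosyz_map (qcls _ f) = qcls _ f'.
Proof.
rewrite /cosyz_map; case: cid => g' /= Hg' Hf'.
by apply: cosyz_lift_unique Hg' Hf'; rewrite qrepK.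
Qed.

Program Definition Omega_co : functor (stableI E) (stableI E) :=
  @Functor (stableI E) (stableI E) (cosyz O) cosyz_map _ _.
Next Obligation.
move=> X; apply: cosyz_mapE; exists (idm _).
by rewrite !mcomp1f !mcompf1.
Qed.
Next Obligation.
move=> X Y Z g f; rewrite -(qrepK g) -(qrepK f) [X in cosyz_map X]qcompE.
have [g' Hg] := cosyz_lift_ex (qrep g); have [f' Hf] := cosyz_lift_ex (qrep f).
rewrite (cosyz_mapE Hg) (cosyz_mapE Hf) [RHS]qcompE.
apply: cosyz_mapE; have [p [p1 p2]] := Hg; have [r [r1 r2]] := Hf.
exists (p \oc r); split; first by rewrite -mcompA r1 mcompA p1 mcompA.
by rewrite mcompA p2 -mcompA r2 mcompA.
Qed.

End Cosyzygy.

Section HalfExact.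
Variables (E : exactCat) (A : preadditive) (F : functor E A).

(* The value of F at a morphism of E / W, computed on a representative; by
   stable_fmapE below it does not depend on the representative. *)
Definition stable_fmap (W : sum_class E) (X Y : E)
    (q : @mor (ideal_quotient W) X Y) : mor (F X) (F Y) := fmap F (qrep q).

Lemma split_conflation (X Y S : E) (i1 : mor X S) (i2 : mor Y S)
    (p1 : mor S X) (p2 : mor S Y) :
  is_biproduct i1 i2 p1 p2 -> conflation i1 p2.
Proof.
move=> [e1 e2 e12 e21 eS].
have [K [k kY]] := defl_id Y.
have k0 : k = 0 by have [] := conf_kernel kY; rewrite mcomp1f.
have ik : inflation k by exists Y, (idm Y).
have [B [i [b [[ci univ] [D [p ip]]]]]] := infl_pushout (0 : mor K X) ik.
have [|w [[wi wb] _]] := univ _ i1 i2; first by rewrite k0 !mcompf0.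
pose v := i \oc p1 + b \oc p2.
have vw : v \oc w = idm B.
  have [|t [_ tU]] := univ _ i b; first by rewrite k0 !mcompf0.
  rewrite -(tU (v \oc w)) ?(tU (idm B)) // ?mcomp1f //.
  by rewrite -!mcompA wi wb !mcompDl -!mcompA e1 e2 e12 e21 !mcompf1 !mcompf0 addr0 add0r.
have wv : w \oc v = idm S by rewrite mcompDr !mcompA wi wb.
have [pi0 univp] := conf_cokernel ip.
have [|s [sp _]] := univp _ (p2 \oc w); first by rewrite -mcompA wi.
apply: (@conf_iso E _ _ _ _ _ _ i p i1 p2 (idm X) w s) => //.
- by exists (idm X); rewrite mcomp1f.
- by exists v.
- exists (p \oc b); split; last by rewrite mcompA sp -mcompA wb.
  apply: (cokernel_epic (conf_cokernel ip)).
  rewrite -mcompA sp mcomp1f -[RHS]mcompf1 -vw mcompDl mcompDr -!mcompA.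
  by rewrite [p \oc (i \oc _)]mcompA pi0 mcomp0f add0r.
- by rewrite wi mcompf1.
Qed.

Lemma stable_fmapE (W : sum_class E) (X Y : E) (f : mor X Y) :
  half_exact F -> (forall Z, W Z -> is_zero (F Z)) ->
  stable_fmap (qcls W f) = fmap F f.
Proof.
move=> hF F0; set g := qrep (qcls W f).
have /qclsP[Z [v [u [WZ fg]]]] : qcls W g = qcls W f by apply: qrepK.
have [_ /(_ X Z)[S [i1 [i2 [p1 [p2 S_X_Z]]]]]] := ecat_additive E.
have [e1 e2 e12 e21 eS] := S_X_Z.
have [I [m [[Q [q [[qf qP] [qm _]]]] [_ mP]]]] := hF _ _ _ _ _ (split_conflation S_X_Z).
have [_ FZ0] := F0 _ WZ.
have [|s [ms _]] := mP _ (idm _); first exact: FZ0.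
have q0 : q = 0 by rewrite -[q]mcompf1 -ms mcompA qm mcomp0f.
have epi : is_epi (fmap F i1).
  move=> T a b ab; apply/eqP; rewrite -subr_eq0; apply/eqP.
  have [|t [<- _]] := qP _ (a - b); first by rewrite mcompBl ab subrr.
  by rewrite q0 mcompf0.
have FS : fmap F i1 \oc fmap F p1 = idm _.
  by apply: epi; rewrite -mcompA -fmap_comp e1 fmap1 mcompf1 mcomp1f.
pose d := i1 + i2 \oc u; pose c := f \oc p1 + v \oc p2.
have gE : g = c \oc d.
  rewrite mcompDl !mcompDr -!mcompA (mcompA p1) (mcompA p2 i2) e1 e2 e12 e21.
  by rewrite mcomp0f !mcompf0 mcomp1f mcompf1 addr0 add0r -fg addrC subrK.
have fE : f = c \oc i1 by rewrite mcompDl -!mcompA e1 e21 mcompf0 mcompf1 addr0.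
have p1d : p1 \oc d = idm X by rewrite mcompDr mcompA e1 e12 mcomp0f addr0.
rewrite /stable_fmap -/g gE fmap_comp -[fmap F d]mcomp1f -FS.
by rewrite -mcompA -fmap_comp p1d fmap1 mcompf1 -fmap_comp -fE.
Qed.

End HalfExact.

Section LongExactSequence.
Variables (E : exactCat) (A : preadditive) (F : functor E A).
Variables (O : syzygies E) (O' : cosyzygies E).

Definition Om (n : nat) (X : E) : E := functor_iter (Omega O) n X.
Definition Co (n : nat) (X : E) : E := functor_iter (Omega_co O') n X.

(* F (Omega^n f), with Omega^0 f = f. *)
Definition F_Om (n : nat) (X Y : E) (f : mor X Y) :
    mor (F (Om n X)) (F (Om n Y)) :=
  match n with
  | 0 => fmap F f
  | m.+1 => stable_fmap F (fmap (functor_iter (Omega O) m.+1) (qcls (proj_class E) f))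
  end.

(* F ((Omega^-)^n f), with (Omega^-)^0 f = f. *)
Definition F_Co (n : nat) (X Y : E) (f : mor X Y) :
    mor (F (Co n X)) (F (Co n Y)) :=
  match n with
  | 0 => fmap F f
  | m.+1 => stable_fmap F (fmap (functor_iter (Omega_co O') m.+1) (qcls (inj_class E) f))
  end.

(* Every term of
     ... -> F(Om n.+1 C) -> F(Om n A) -> F(Om n B) -> F(Om n C) -> ...
         -> F(A) -> F(B) -> F(C) -> ...
         -> F(Co n A) -> F(Co n B) -> F(Co n C) -> F(Co n.+1 A) -> ...
   is listed; n = 0 gives twice the exactness at F(B). *)
Definition long_exact (S : ses E) (h : mor (sesC S) (cosyz O' (sesA S)))
    (h' : mor (syz O (sesC S)) (sesA S)) : Prop :=
  (forall n : nat,
     [/\ exact_at (F_Om n.+1 (sesg S)) (F_Om n h'),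
         exact_at (F_Om n h') (F_Om n (sesf S))
       & exact_at (F_Om n (sesf S)) (F_Om n (sesg S))]) /\
  (forall n : nat,
     [/\ exact_at (F_Co n (sesf S)) (F_Co n (sesg S)),
         exact_at (F_Co n (sesg S)) (F_Co n h)
       & exact_at (F_Co n h) (F_Co n.+1 (sesf S))]).

Definition long_exact_commutes (S T : ses E)
    (h : mor (sesC S) (cosyz O' (sesA S))) (h' : mor (syz O (sesC S)) (sesA S))
    (k : mor (sesC T) (cosyz O' (sesA T))) (k' : mor (syz O (sesC T)) (sesA T))
    (a : mor (sesA S) (sesA T)) (b : mor (sesB S) (sesB T))
    (c : mor (sesC S) (sesC T)) : Prop :=
  (forall n : nat,
     [/\ F_Om n a \oc F_Om n h' = F_Om n k' \oc F_Om n.+1 c,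
         F_Om n b \oc F_Om n (sesf S) = F_Om n (sesf T) \oc F_Om n a
       & F_Om n c \oc F_Om n (sesg S) = F_Om n (sesg T) \oc F_Om n b]) /\
  (forall n : nat,
     [/\ F_Co n b \oc F_Co n (sesf S) = F_Co n (sesf T) \oc F_Co n a,
         F_Co n c \oc F_Co n (sesg S) = F_Co n (sesg T) \oc F_Co n b
       & F_Co n.+1 a \oc F_Co n h = F_Co n k \oc F_Co n c]).

End LongExactSequence.

(* Main.v *)
Require Import Defs.
From mathcomp Require Import all_boot all_algebra.
From mathcomp Require Import boolp.

(** The idea is that the whole sequence is obtained by applying half exact
    functors to a handful of short exact sequences built from A >-> B ->> C.

    Write [Omega X >-> P_X ->> X] for the chosen presentations.  A connecting
    morphism [h' : Omega C -> A] is nothing but a lift of the identity of C, from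
    the presentation of C to the given short exact sequence.  Lifts from a
    projective presentation exist, compose, and any two of them differ by a
    morphism that factors through a projective object ([ses_lift_ex],
    [ses_lift_comp], [ses_lift_unique]); as F identifies such morphisms
    ([fmap_stable]), every commutation with a connecting morphism, in
    particular naturality, holds because two composites are lifts of the same morphism.

    Exactness at F(A): for q : P_C -> B over C, the sequence
    Omega C >-> A (+) P_C ->> B is a conflation, and F does not see P_C
    ([cone_conflation], [exact_connecting]).  For the two other places, let L be
    the kernel of the composite deflation P_B ->> B ->> C.  Then
    L >-> P_B ->> C is another presentation of C, so that F(L) and F(Omega C) are
    isomorphic, and Omega B >-> L ->> A is a conflation whose maps become Omega g and h' under
    this identification; half exactness gives exactness at F(Omega C).
    The connecting morphism of Omega B >-> L ->> A is Omega f, so that the case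
    already treated gives exactness at F(Omega B) ([les_step]).

    This last fact says that X |-> F(Omega X) is again half exact, and it kills
    projectives; so the argument applies to F(Omega^n -) for every n.

    The right half of the sequence is the left half for the opposite exact
    category: both the axioms of an exact category and the notion of
    exactness used here are self-dual ([exact_at_op]). *)

Set Implicit Arguments.
Unset Strict Implicit.
Unset Printing Implicit Defensive.

Import GRing.Theory.
Local Open Scope ring_scope.
#[local] Obligation Tactic := idtac.

(** * Exactness in a preadditive category *)

Section Exactness.
Variable C : preadditive.

Lemma kernel_iso (K K' X Y : C) (k : mor K X) (k' : mor K' X) (f : mor X Y) :
  is_kernel k f -> is_kernel k' f -> exists2 a, is_iso a & k' \oc a = k.
Proof.
move=> Kk Kk'; have [fk kP] := Kk; have [fk' k'P] := Kk'.
have [a [aE _]] := k'P _ _ fk; have [b [bE _]] := kP _ _ fk'.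
exists a => //; exists b; split.
- by apply: (kernel_monic Kk); rewrite mcompA bE aE mcompf1.
- by apply: (kernel_monic Kk'); rewrite mcompA aE bE mcompf1.
Qed.

Lemma idm_iso (X : C) : is_iso (idm X).
Proof. by exists (idm X); rewrite mcomp1f. Qed.

Lemma square_inv (X Y X' Y' : C) (x : mor X Y) (x' : mor X' Y')
    (s : mor X' X) (s' : mor X X') (t : mor Y' Y) (t' : mor Y Y') :
  s \oc s' = idm X -> t' \oc t = idm Y' -> x \oc s = t \oc x' ->
  t' \oc x = x' \oc s'.
Proof.
by move=> ss tt xs; rewrite -[x]mcompf1 -ss (mcompA x) xs !mcompA tt mcomp1f.
Qed.

Lemma is_iso_mono (X Y : C) (f : mor X Y) : is_iso f -> is_mono f.
Proof.
by move=> [g [gf _]] T u v fuv; rewrite -[u]mcomp1f -[v]mcomp1f -gf -!mcompA fuv.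
Qed.

Lemma is_zeroP (X : C) : idm X = 0 -> is_zero X.
Proof.
move=> X0; split=> Y f g.
- by rewrite -[f]mcompf1 -[g]mcompf1 X0 !mcompf0.
- by rewrite -[f]mcomp1f -[g]mcomp1f X0 !mcomp0f.
Qed.

(** The target of v may be embedded in a larger object, since only the kernel
    of v matters. *)
Lemma exact_at_iso (X Y Z Y' Z' : C) (u : mor X Y) (v : mor Y Z)
    (b : mor Y Y') (c : mor Z Z') (u' : mor X Y') (v' : mor Y' Z') :
  exact_at u v -> is_iso b -> is_mono c -> u' = b \oc u ->
  v' \oc b = c \oc v -> exact_at u' v'.
Proof.
move=> [I [m [[Q [q [[qu qP] [qm mP]]]] [vm nP]]]] [d [db bd]] cM -> vE.
have v'E : v' = c \oc v \oc d by rewrite -vE -mcompA bd mcompf1.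
have bK T (s t : mor T Y) : b \oc s = b \oc t -> s = t.
  by move=> st; rewrite -[s]mcomp1f -[t]mcomp1f -db -!mcompA st.
have dE T (t : mor T Y') : b \oc (d \oc t) = t by rewrite mcompA bd mcomp1f.
exists I, (b \oc m); split; first exists Q, (q \oc d); first split.
- split=> [|T t tE]; first by rewrite mcompA -(mcompA q) db mcompf1.
  have [|s [sE sU]] := qP _ (t \oc b); first by rewrite -mcompA.
  exists s; split=> [|s' s'E]; first by rewrite mcompA sE -mcompA bd mcompf1.
  by apply: sU; rewrite -s'E -!mcompA db mcompf1.
- split=> [|T t tE]; first by rewrite mcompA -(mcompA q) db mcompf1.
  have [|s [sE sU]] := mP _ (d \oc t); first by rewrite mcompA.
  exists s; split=> [|s' s'E]; first by rewrite -mcompA sE dE.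
  by apply: sU; apply: bK; rewrite dE mcompA.
- split=> [|T t tE]; first by rewrite mcompA vE -mcompA vm mcompf0.
  have [|s [sE sU]] := nP _ (d \oc t).
    by apply: cM; rewrite mcompf0 -tE v'E -!mcompA.
  exists s; split=> [|s' s'E]; first by rewrite -mcompA sE dE.
  by apply: sU; apply: bK; rewrite dE mcompA.
Qed.

End Exactness.

(** * Conflations *)

Section Conflations.
Variable E : exactCat.

(** All kernels of a deflation are isomorphic to the one that makes it part of a
    conflation, and conflations are closed under isomorphism. *)
Lemma deflation_kernel_conflation (X Y Z : E) (i : mor X Y) (p : mor Y Z) :
  deflation p -> is_kernel i p -> conflation i p.
Proof.
move=> [X0 [i0 ip0]] ker_i.
have [a a_iso aE] := kernel_iso (conf_kernel ip0) ker_i.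
apply: (@conf_iso E _ _ _ _ _ _ i0 p i p a (idm _) (idm _)) ip0 => //;
  try exact: idm_iso.
- by rewrite mcomp1f.
- by rewrite mcomp1f mcompf1.
Qed.

(** The axioms provide one pullback that is a deflation; all pullbacks are
    isomorphic to it. *)
Lemma pullback_deflation (B' C' B X : E) (p' : mor B' C') (b : mor B' B)
    (p : mor B X) (c : mor C' X) :
  is_pullback p' b p c -> deflation p -> deflation p'.
Proof.
move=> [sq univ] /(defl_pullback c)[B0 [p0 [b0 [[sq0 univ0] [A0 [i0 ip0]]]]]].
have [w [[wp wb] _]] := univ _ _ _ sq0; have [v [[vp vb] _]] := univ0 _ _ _ sq.
have vw : v \oc w = idm B0.
  have [t [_ tU]] := univ0 _ _ _ sq0.
  rewrite -(tU (v \oc w)); first by apply: tU; rewrite !mcompf1.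
  by rewrite !mcompA vp vb.
have wv : w \oc v = idm B'.
  have [t [_ tU]] := univ _ _ _ sq.
  rewrite -(tU (w \oc v)); first by apply: tU; rewrite !mcompf1.
  by rewrite !mcompA wp wb.
exists A0, (w \oc i0).
apply: (@conf_iso E _ _ _ _ _ _ i0 p0 _ p' (idm _) w (idm _)) ip0;
  try exact: idm_iso.
- by exists v.
- by rewrite mcompf1.
- by rewrite mcomp1f.
Qed.

(** The kernel of g p is the preimage under p of the kernel of g. *)
Lemma kernel_comp_pullback (X Y Z K L : E) (g : mor Y Z) (p : mor X Y)
    (f : mor K Y) (l : mor L X) (v : mor L K) :
  is_kernel f g -> is_kernel l (g \oc p) -> f \oc v = p \oc l ->
  is_pullback v l p f.
Proof.
move=> kf kl fv; have [gf _] := kf; have [_ lP] := kl.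
split=> // T u t tu; have [|s [sE sU]] := lP _ t.
  by rewrite -mcompA tu mcompA gf mcomp0f.
exists s; split=> [|s' [_ /sU //]]; split=> //.
by apply: (kernel_monic kf); rewrite mcompA fv -mcompA sE.
Qed.

(** The third isomorphism theorem: (ker g p) / (ker p) = ker g.  The quotient map
    v is a deflation because it is the pullback of p along f. *)
Lemma kernel_comp_conflation (K A B C Q L : E) (i : mor K Q) (p : mor Q B)
    (f : mor A B) (g : mor B C) (l : mor L Q) :
  conflation i p -> conflation f g -> conflation l (g \oc p) ->
  exists (w : mor K L) (v : mor L A),
    [/\ conflation w v, l \oc w = i & f \oc v = p \oc l].
Proof.
move=> ip fg lgp; have kip := conf_kernel ip; have kfg := conf_kernel fg.
have klgp := conf_kernel lgp; have [pi0 iP] := kip.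
have [gf0 fP] := kfg; have [gpl0 lP] := klgp.
have [|v [vE _]] := fP _ (p \oc l); first by rewrite mcompA.
have [|w [wE _]] := lP _ i; first by rewrite -mcompA pi0 mcompf0.
exists w, v; split=> //; apply: deflation_kernel_conflation.
  apply: (pullback_deflation (kernel_comp_pullback kfg klgp vE)).
  by exists K, i.
split=> [|T t vt].
  by apply: (kernel_monic kfg); rewrite mcompA vE -mcompA wE pi0 mcompf0.
have [|s [sE sU]] := iP _ (l \oc t).
  by rewrite mcompA -vE -mcompA vt mcompf0.
exists s; split=> [|s' s'E]; last by apply: sU; rewrite -s'E mcompA wE.
by apply: (kernel_monic klgp); rewrite mcompA wE.
Qed.

(** The middle object is the pullback of p and g, split by q; this is why its
    projection to B is a deflation. *)
Lemma cone_conflation (K Q A B C D : E) (i : mor K Q) (p : mor Q C)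
    (f : mor A B) (g : mor B C) (q : mor Q B) (h : mor K A)
    (j1 : mor A D) (j2 : mor Q D) (p1 : mor D A) (p2 : mor D Q) :
  conflation i p -> conflation f g -> g \oc q = p -> q \oc i = f \oc h ->
  is_biproduct j1 j2 p1 p2 ->
  conflation (j1 \oc h - j2 \oc i) (f \oc p1 + q \oc p2).
Proof.
move=> ip fg gq qi [e1 e2 e12 e21 eD].
have kip := conf_kernel ip; have kfg := conf_kernel fg.
have [pi0 iP] := kip; have [gf0 fP] := kfg.
have jE T (t : mor T D) : j1 \oc (p1 \oc t) + j2 \oc (p2 \oc t) = t.
  by rewrite !mcompA -mcompDl eD mcomp1f.
have p1j T (s : mor T A) (t : mor T Q) : p1 \oc (j1 \oc s + j2 \oc t) = s.
  by rewrite mcompDr !mcompA e1 e12 mcomp1f mcomp0f addr0.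
have p2j T (s : mor T A) (t : mor T Q) : p2 \oc (j1 \oc s + j2 \oc t) = t.
  by rewrite mcompDr !mcompA e2 e21 mcomp1f mcomp0f add0r.
rewrite -mcompNr; apply: deflation_kernel_conflation.
  apply: (@pullback_deflation _ _ _ _ _ p2 p g); last by exists K, i.
  split=> [|T u t tu]; first by rewrite mcompDr !mcompA gf0 mcomp0f add0r gq.
  have [|a [aE aU]] := fP _ (u - q \oc t).
    by rewrite mcompBr mcompA gq tu subrr.
  exists (j1 \oc a + j2 \oc t); split=> [|w [wE wt]].
    by rewrite p2j mcompDl -!mcompA p1j p2j aE subrK.
  rewrite -[RHS]jE wt; congr (_ \oc _ + _); apply: aU.
  by rewrite -wE mcompDl -!mcompA wt addrK.
split=> [|T t tE].
  by rewrite mcompDl -!mcompA p1j p2j mcompNr qi subrr.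
have tE' : f \oc (p1 \oc t) = - (q \oc (p2 \oc t)).
  by apply/eqP; rewrite -addr_eq0 -tE mcompDl -!mcompA.
have [|s [sE sU]] := iP _ (- (p2 \oc t)).
  by rewrite -gq mcompNr -mcompA -mcompNr -tE' mcompA gf0 mcomp0f.
have hs : h \oc s = p1 \oc t.
  apply: (kernel_monic kfg).
  by rewrite mcompA -qi -mcompA sE mcompNr tE'.
exists s; split=> [|s' s'E].
  by rewrite mcompDl -!mcompA hs mcompNl sE opprK jE.
by apply: sU; rewrite -s'E mcompDl -!mcompA p2j mcompNl opprK.
Qed.

End Conflations.

(** * Lifts between short exact sequences *)

Section Lifts.
Variable E : exactCat.

(** Between the chosen presentations this is [syz_lift], up to conversion. *)
Definition ses_lift (S T : ses E) (c : mor (sesC S) (sesC T))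
    (a : mor (sesA S) (sesA T)) : Prop :=
  exists b : mor (sesB S) (sesB T),
    sesg T \oc b = c \oc sesg S /\ b \oc sesf S = sesf T \oc a.

Lemma ses_lift_comp (S T U : ses E) c a d b :
  @ses_lift T U d b -> @ses_lift S T c a -> ses_lift (d \oc c) (b \oc a).
Proof.
move=> [s [sg sf]] [r [rg rf]]; exists (s \oc r); split.
- by rewrite mcompA sg -mcompA rg mcompA.
- by rewrite -mcompA rf mcompA sf mcompA.
Qed.

Lemma ses_lift_id (S : ses E) : @ses_lift S S (idm _) (idm _).
Proof. by exists (idm _); rewrite !mcompf1 !mcomp1f. Qed.

Lemma ses_lift_ex (S T : ses E) (c : mor (sesC S) (sesC T)) :
  projective_obj (sesB S) -> exists a, ses_lift c a.
Proof.
move=> PS; have dT : deflation (sesg T).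
  by exists (sesA T), (sesf T); apply: ses_conf.
have [b bE] := PS _ _ _ dT (c \oc sesg S).
have [gf0 _] := conf_kernel (ses_conf S).
have [_ /(_ _ (b \oc sesf S))] := conf_kernel (ses_conf T).
case; first by rewrite mcompA bE -mcompA gf0 mcompf0.
by move=> a [aE _]; exists a, b.
Qed.

Lemma ses_lift_unique (S T : ses E) (c : mor (sesC S) (sesC T)) a a' :
  projective_obj (sesB S) -> ses_lift c a -> ses_lift c a' ->
  factors_through (@projective_obj E) (a - a').
Proof.
move=> PS [b [bg bf]] [b' [bg' bf']]; have kT := conf_kernel (ses_conf T).
have [_ /(_ _ (b - b'))] := kT.
case; first by rewrite mcompBr bg bg' subrr.
move=> s [sE _]; exists (sesB S), s, (sesf S); split=> //.
by apply: (kernel_monic kT); rewrite mcompA sE mcompBl bf bf' mcompBr.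
Qed.

End Lifts.

(** * One step of the long exact sequence *)

Section Step.
Variables (E : exactCat) (A : preadditive) (H : functor E A).
Hypothesis H_half_exact : half_exact H.
Hypothesis H_proj : forall P : E, projective_obj P -> is_zero (H P).

(** The form in which the passage to the stable category is used: lifts are only
    determined up to such morphisms. *)
Lemma fmap_stable (X Y : E) (f g : mor X Y) :
  factors_through (@projective_obj E) (f - g) -> fmap H f = fmap H g.
Proof.
move=> /(qclsP (proj_class E)) fg.
have sE := @stable_fmapE _ _ H (proj_class E) X Y _ H_half_exact H_proj.
by rewrite -[LHS]sE fg sE.
Qed.

(** Additivity of H on zero morphisms comes from their factoring through a zero
    object, which is projective. *)
Lemma fmap0 (X Y : E) : fmap H (0 : mor X Y) = 0.
Proof.
have [[Z Z0] _] := ecat_additive E.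
rewrite -(mcomp0f Y (0 : mor X Z)) fmap_comp.
by rewrite ((H_proj (zero_projective Z0)).2 _ (fmap H 0) 0) mcompf0.
Qed.

Lemma fmap_ses_lift (S T : ses E) c a a' :
  projective_obj (sesB S) -> @ses_lift E S T c a -> ses_lift c a' ->
  fmap H a = fmap H a'.
Proof. by move=> PS la la'; apply/fmap_stable/(ses_lift_unique PS la la'). Qed.

(** Schanuel's lemma: lifts of c and of its inverse compose to lifts of
    identities, hence are stably inverse to each other. *)
Lemma fmap_ses_lift_iso (S T : ses E) c a :
  projective_obj (sesB S) -> projective_obj (sesB T) -> is_iso c ->
  @ses_lift E S T c a -> is_iso (fmap H a).
Proof.
move=> PS PT [d [dc cd]] la; have [b lb] := ses_lift_ex d PT.
exists (fmap H b); rewrite -!fmap_comp -!fmap1; split.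
- apply: (fmap_ses_lift PS (ses_lift_comp lb la)).
  by rewrite dc; apply: ses_lift_id.
- apply: (fmap_ses_lift PT (ses_lift_comp la lb)).
  by rewrite cd; apply: ses_lift_id.
Qed.

(** Half exactness on the conflation of [cone_conflation], whose middle
    object is sent by H to H(A). *)
Lemma exact_connecting (U S : ses E) c (h : mor (sesA U) (sesA S)) :
  projective_obj (sesB U) -> is_iso c ->
  @ses_lift E U S c h -> exact_at (fmap H h) (fmap H (sesf S)).
Proof.
move=> PU c_iso [q [gq qi]].
have [_ /(_ (sesA S) (sesB U))[D [j1 [j2 [p1 [p2 bip]]]]]] := ecat_additive E.
have ucp : conflation (sesf U) (c \oc sesg U).
  apply: (@conf_iso E _ _ _ _ _ _ _ _ _ _ (idm _) (idm _) c) (ses_conf U) => //;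
    try exact: idm_iso.
  - by rewrite mcomp1f mcompf1.
  - by rewrite mcompf1.
have cone := H_half_exact (cone_conflation ucp (ses_conf S) gq qi bip).
have [e1 e2 e12 e21 eD] := bip.
apply: (exact_at_iso (b := fmap H p1) (c := idm _) cone).
- exists (fmap H j1); rewrite -!fmap_comp e1 !fmap1; split=> //.
  rewrite -(fmap1 H); apply: fmap_stable.
  exists (sesB U), (- j2), p2; split=> //.
  by rewrite -eD opprD addrA subrr sub0r mcompNl.
- exact/is_iso_mono/idm_iso.
- by rewrite -fmap_comp mcompBr !mcompA e1 e12 mcomp1f mcomp0f subr0.
- rewrite mcomp1f -fmap_comp; apply: fmap_stable.
  exists (sesB U), (- q), p2; split=> //.
  by rewrite opprD addrA subrr sub0r mcompNl.
Qed.

Variable O : syzygies E.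

Definition syz_ses (X : E) : ses E := Ses (syz_conf O X).

Definition connecting (S : ses E) (h : mor (syz O (sesC S)) (sesA S)) : Prop :=
  @ses_lift E (syz_ses (sesC S)) S (idm _) h.

(** The two conflations in the proof are L >-> P_B ->> C and Omega B >-> L ->> A,
    where L is the kernel of the composite P_B ->> B ->> C.  The third exactness
    says that H(Omega -) is half exact. *)
Lemma les_step (S : ses E) f' g' h :
  @syz_lift E O _ _ (sesf S) f' -> @syz_lift E O _ _ (sesg S) g' ->
  connecting h ->
  [/\ exact_at (fmap H g') (fmap H h), exact_at (fmap H h) (fmap H (sesf S))
    & exact_at (fmap H f') (fmap H g')].
Proof.
case: S f' g' h => X Y Z f g fg f' g' h /= lf lg lh.
have iZ := idm_iso Z; have iX := idm_iso X.
have Pproj V : projective_obj (sesB (syz_ses V)) by apply: (@syz_proj _ O V).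
have dg : deflation g by exists X, f.
have dp : deflation (syz_p O Y) by exists (syz O Y), (syz_i O Y); apply: syz_conf.
have [L [l lgp]] := defl_comp dg dp.
have [w [v [wv lw fv]]] := kernel_comp_conflation (syz_conf O Y) fg lgp.
pose SL : ses E := Ses lgp; pose SX : ses E := Ses wv; pose SY : ses E := Ses fg.
have PL : projective_obj (sesB SL) by apply: Pproj.
have [e le] := @ses_lift_ex E SL (syz_ses Z) (idm Z) PL.
have e_iso : is_iso (fmap H e).
  exact: (@fmap_ses_lift_iso SL (syz_ses Z) _ _ PL (Pproj Z) iZ le).
(* The morphism w is a lift of g, and v is a lift of the identity of Z. *)
have gE : fmap H g' = fmap H e \oc fmap H w.
  rewrite -fmap_comp.
  apply: (@fmap_ses_lift (syz_ses Y) (syz_ses Z) g _ _ (Pproj Y) lg).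
  rewrite -[g]mcomp1f; apply: (@ses_lift_comp E _ SL _) le _.
  by exists (idm _); rewrite mcompf1 mcomp1f.
have vE : fmap H v = fmap H h \oc fmap H e.
  rewrite -fmap_comp; apply: (@fmap_ses_lift SL SY (idm Z) _ _ PL).
    by exists (syz_p O Y); rewrite mcomp1f.
  by rewrite -[idm Z]mcomp1f; apply: (@ses_lift_comp E _ (syz_ses Z) SY) lh le.
split; last 1 first.
- have [t lt] := @ses_lift_ex E (syz_ses X) SX (idm X) (Pproj X).
  have := @exact_connecting (syz_ses X) SX _ t (Pproj X) iX lt.
  have -> : fmap H f' = fmap H t.
    apply: (@fmap_ses_lift (syz_ses X) (syz_ses Y) f _ _ (Pproj X) lf).
    rewrite -[f]mcompf1 -[t]mcomp1f.
    apply: (@ses_lift_comp E _ SX (syz_ses Y)) _ lt.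
    by exists l; rewrite mcompf1 fv.
  move=> /exact_at_iso; apply; first exact: idm_iso.
  + exact: is_iso_mono e_iso.
  + by rewrite mcomp1f.
  + by rewrite mcompf1.
- apply: (exact_at_iso (c := idm _) (H_half_exact wv) e_iso) gE _.
    exact/is_iso_mono/idm_iso.
  by rewrite mcomp1f vE.
- exact: (@exact_connecting (syz_ses Z) SY _ h (Pproj Z) iZ lh).
Qed.

(** Both a h and k c' are lifts of c, from the presentation of the third object of
    S to T. *)
Lemma connecting_natural (S T : ses E) (a : mor (sesA S) (sesA T))
    (b : mor (sesB S) (sesB T)) (c : mor (sesC S) (sesC T)) c' h k :
  b \oc sesf S = sesf T \oc a -> c \oc sesg S = sesg T \oc b ->
  connecting h ->
  connecting k ->
  @syz_lift E O _ _ c c' -> fmap H a \oc fmap H h = fmap H k \oc fmap H c'.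
Proof.
move=> bf cg lh lk lc; rewrite -!fmap_comp.
apply: (@fmap_ses_lift (syz_ses (sesC S)) T c); first exact: (@syz_proj _ O).
- rewrite -[c]mcompf1; apply: ses_lift_comp lh.
  by exists b; rewrite cg.
- rewrite -[c]mcomp1f.
  exact: (@ses_lift_comp E (syz_ses (sesC S)) (syz_ses _) T _ _ _ _ lk lc).
Qed.

(** A syzygy of a projective object is killed by H: the identity of P is stably
    zero, and so is any lift of it. *)
Lemma fmap_syz_lift_proj (P : E) f' :
  projective_obj P -> @syz_lift E O _ _ (idm P) f' -> fmap H f' = 0.
Proof.
move=> PP lf; rewrite -(fmap0 (syz O P) (syz O P)); apply: fmap_stable.
apply/(qclsP (proj_class E)); apply: (syz_lift_unique _ lf); last first.
  by exists 0; rewrite !mcompf0 !mcomp0f; split; [apply: esym; apply: mcomp0f|].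
by apply/qclsP; rewrite subr0; exists P, (idm P), (idm P); rewrite mcomp1f.
Qed.

End Step.

(** * Duality *)

Program Definition op_cat (C : preadditive) : preadditive :=
  @Preadditive C (fun X Y => mor Y X) (fun X => idm X)
    (fun X Y Z g f => f \oc g) _ _ _ _ _.
Next Obligation. by move=> * /=; rewrite mcompA. Qed.
Next Obligation. by move=> * /=; rewrite mcompf1. Qed.
Next Obligation. by move=> * /=; rewrite mcomp1f. Qed.
Next Obligation. by move=> * /=; rewrite mcompDr. Qed.
Next Obligation. by move=> * /=; rewrite mcompDl. Qed.

Program Definition op_functor (C D : preadditive) (F : functor C D) :
    functor (op_cat C) (op_cat D) :=
  @Functor (op_cat C) (op_cat D) F (fun X Y f => fmap F f) _ _.
Next Obligation. by move=> *; rewrite /= fmap1. Qed.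
Next Obligation. by move=> *; rewrite /= fmap_comp. Qed.

Lemma is_zero_op (C : preadditive) (X : C) :
  is_zero X -> is_zero (X : op_cat C).
Proof. by move=> []. Qed.

(** Exactness of u, v at Y means that a kernel m of v is a kernel of a cokernel q
    of u; then u factors through m, so that q is in turn a cokernel of m, which is
    the dual condition. *)
Lemma exact_at_op (C : preadditive) (X Y Z : C) (u : mor X Y) (v : mor Y Z) :
  exact_at u v -> @exact_at (op_cat C) Z Y X v u.
Proof.
move=> [I [m [[Q [q [cq km]]] kv]]].
exists Q, q; split=> //; exists I, m; split=> //.
have [qm _] := km; have [vm vP] := kv; have [_ qP] := cq.
split=> //= T t tm; have tu : t \oc u = 0.
  have [qu _] := cq; have [_ mP] := km.
  by have [s [<- _]] := mP _ u qu; rewrite mcompA tm mcomp0f.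
exact: qP.
Qed.

Program Definition op_exact (E : exactCat) : exactCat :=
  @ExactCat (op_cat E) _ (fun A B C i p => @conflation E C B A p i)
    _ _ _ _ _ _ _ _ _.
Next Obligation.
move=> E; have [[O O0] bip] := ecat_additive E; split.
  by exists O; apply: is_zero_op.
move=> X Y; have [S [i1 [i2 [p1 [p2 [e1 e2 e12 e21 eS]]]]]] := bip X Y.
by exists S, p1, p2, i1, i2.
Qed.
Next Obligation. by move=> E A B C i p; apply: conf_cokernel. Qed.
Next Obligation. by move=> E A B C i p; apply: conf_kernel. Qed.
Next Obligation.
move=> E A B C A' B' C' i p i' p' a b c /=.
move=> [a' /= [a1 a2]] [b' /= [b1 b2]] [c' /= [c1 c2]] bi cp.
apply: (@conf_iso E _ _ _ _ _ _ p i p' i' c' b' a').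
- by exists c.
- by exists b.
- by exists a.
- exact: square_inv c1 b2 cp.
- exact: square_inv b1 a2 bi.
Qed.
Next Obligation. by move=> E A; apply: defl_id. Qed.
Next Obligation. by move=> E A; apply: infl_id. Qed.
Next Obligation. by move=> E A B C j i dj di; apply: defl_comp. Qed.
Next Obligation. by move=> E A B C j i dj di; apply: infl_comp. Qed.
Next Obligation. by move=> E A B A' i a; apply: defl_pullback. Qed.
Next Obligation. by move=> E A B A' i a; apply: infl_pushout. Qed.

Lemma op_half_exact (E : exactCat) (A : preadditive) (F : functor E A) :
  half_exact F -> @half_exact (op_exact E) (op_cat A) (op_functor F).
Proof. by move=> hF X Y Z f g gf; apply/exact_at_op/hF. Qed.

Lemma op_projective (E : exactCat) (I : E) :
  @projective_obj (op_exact E) I -> injective_obj I.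
Proof. by move=> PI X Y i ii f; apply: (PI Y X i ii f). Qed.

Definition op_syzygies (E : exactCat) (O : cosyzygies E) :
    syzygies (op_exact E) :=
  @Syzygies (op_exact E) (cosyz O) (cosyzI O) (cosyz_p O) (cosyz_i O)
    (fun X Y Z p dp f => @cosyz_inj E O X Z Y p dp f) (cosyz_conf O).

Definition op_ses (E : exactCat) (S : ses E) : ses (op_exact E) :=
  @Ses (op_exact E) _ _ _ (sesg S) (sesf S) (ses_conf S).

(** Dually to a connecting morphism, an extension of the identity of the first
    object of S, from S to its injective copresentation. *)
Definition co_connecting (E : exactCat) (O : cosyzygies E) (S : ses E)
    (h : mor (sesC S) (cosyz O (sesA S))) : Prop :=
  @connecting (op_exact E) (op_syzygies O) (op_ses S) h.

Lemma connecting_ex (E : exactCat) (O : syzygies E) (S : ses E) :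
  exists h, @connecting E O S h.
Proof.
exact: (@ses_lift_ex E (syz_ses O (sesC S)) S (idm _) (@syz_proj E O (sesC S))).
Qed.

Lemma co_connecting_ex (E : exactCat) (O : cosyzygies E) (S : ses E) :
  exists h, @co_connecting E O S h.
Proof. exact: (@connecting_ex (op_exact E) (op_syzygies O) (op_ses S)). Qed.

Lemma cosyz_lift_op (E : exactCat) (O : cosyzygies E) (X Y : E)
    (f : mor X Y) f' :
  @cosyz_lift E O X Y f f' ->
  @syz_lift (op_exact E) (op_syzygies O) Y X f f'.
Proof. by move=> [p [pi pp]]; exists p. Qed.

Section CoStep.
Variables (E : exactCat) (A : preadditive) (H : functor E A).
Hypothesis H_half_exact : half_exact H.
Hypothesis H_inj : forall I : E, injective_obj I -> is_zero (H I).
Variable O : cosyzygies E.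

Let op_half := op_half_exact H_half_exact.
Let op_proj (P : op_exact E) (PP : projective_obj P) :
  is_zero (op_functor H P) := is_zero_op (H_inj (op_projective PP)).

Lemma co_les_step (S : ses E) f' g' h :
  @cosyz_lift E O _ _ (sesf S) f' -> @cosyz_lift E O _ _ (sesg S) g' ->
  @co_connecting E O S h ->
  [/\ exact_at (fmap H (sesg S)) (fmap H h), exact_at (fmap H h) (fmap H f')
    & exact_at (fmap H f') (fmap H g')].
Proof.
move=> /cosyz_lift_op lf /cosyz_lift_op lg lh.
by have [e1 e2 e3] := les_step op_half op_proj (S := op_ses S) lg lf lh; split;
  apply: (@exact_at_op (op_cat A)).
Qed.

Lemma co_connecting_natural (S T : ses E) (a : mor (sesA S) (sesA T))
    (b : mor (sesB S) (sesB T)) (c : mor (sesC S) (sesC T)) a' h k :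
  b \oc sesf S = sesf T \oc a -> c \oc sesg S = sesg T \oc b ->
  @co_connecting E O S h -> @co_connecting E O T k ->
  @cosyz_lift E O _ _ a a' -> fmap H a' \oc fmap H h = fmap H k \oc fmap H c.
Proof.
move=> bf cg lh lk /cosyz_lift_op la.
exact: esym (connecting_natural op_half op_proj (S := op_ses T)
  (T := op_ses S) (esym cg) (esym bf) lk lh la).
Qed.

Lemma fmap_cosyz_lift_inj (I : E) f' :
  injective_obj I -> @cosyz_lift E O _ _ (idm I) f' -> fmap H f' = 0.
Proof.
move=> II /cosyz_lift_op lf; apply: (fmap_syz_lift_proj op_half op_proj _ lf).
by move=> Y Z p dp f; apply: (II Z Y p dp f).
Qed.

End CoStep.

(** * Iteration *)

Section Iteration.
Variables (E : exactCat) (A : preadditive) (F : functor E A).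
Variables (W : sum_class E) (G : functor (ideal_quotient W) (ideal_quotient W)).
Hypothesis F_half_exact : half_exact F.
Hypothesis F_W : forall Z : E, W Z -> is_zero (F Z).

Let sE X Y (f : mor X Y) := @stable_fmapE _ _ F W X Y f F_half_exact F_W.

(** The values F(G^n -) as a functor on E itself, so that the one-step lemmas
    apply to it.  On objects, n.+1 at X is n at G X by conversion. *)
Program Definition iterated (n : nat) : functor E A :=
  @Functor E A (fun X => F (functor_iter G n X))
    (fun X Y f => stable_fmap F (fmap (functor_iter G n) (qcls W f))) _ _.
Next Obligation.
move=> n X; apply: etrans (etrans (sE _) (fmap1 F _)).
exact: congr1 (fmap1 (functor_iter G n) X).
Qed.
Next Obligation.
move=> n X Y Z g f; apply: etrans (etrans (sE _) (fmap_comp F _ _)).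
rewrite -qcompE; congr stable_fmap.
exact: (fmap_comp (functor_iter G n) (qcls W g) (qcls W f)).
Qed.

Lemma fmap_iterated0 X Y (f : mor X Y) : fmap (iterated 0) f = fmap F f.
Proof. exact: sE. Qed.

Lemma fmap_iteratedS n (X Y : E) (f : mor X Y) (f' : @mor E (G X) (G Y)) :
  fmap G (qcls W f) = qcls W f' ->
  fmap (iterated n.+1) f = fmap (iterated n) f'.
Proof. by move=> /= ->. Qed.

End Iteration.

(** * The two halves of the long exact sequence *)

Section LeftHalf.
Variables (E : exactCat) (A : preadditive) (F : functor E A) (O : syzygies E).
Hypothesis F_half_exact : half_exact F.
Hypothesis F_proj : forall P : E, projective_obj P -> is_zero (F P).

Let H n : functor E A :=
  @iterated E A F (proj_class E) (Omega O) F_half_exact F_proj n.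

Let HE n (X Y : E) (f : mor X Y) : F_Om F O n f = fmap (H n) f.
Proof. by case: n => [|n] //; rewrite fmap_iterated0. Qed.

Let HS n (X Y : E) (f : mor X Y) f' :
  @syz_lift E O X Y f f' -> fmap (H n.+1) f = fmap (H n) f'.
Proof. by move=> lf; apply/fmap_iteratedS/syz_mapE. Qed.

Lemma iterated_syz_half_exact n :
  half_exact (H n) /\ forall P : E, projective_obj P -> is_zero (H n P).
Proof.
elim: n => [|n [hH H0]]; split=> //.
- by move=> X Y Z f g fg; rewrite !fmap_iterated0; apply: F_half_exact.
- move=> X Y Z f g fg; pose S := Ses fg.
  have [f' lf] := syz_lift_ex O f; have [g' lg] := syz_lift_ex O g.
  have [h lh] := connecting_ex O S.
  rewrite (HS n lf) (HS n lg).
  by have [_ _] := @les_step E A (H n) hH H0 O S f' g' h lf lg lh.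
- move=> P PP; have [f' lf] := syz_lift_ex O (idm P); apply: is_zeroP.
  rewrite -fmap1 (HS n lf); exact: (@fmap_syz_lift_proj E A (H n) hH H0 O P).
Qed.

Lemma left_exact_sequence (S : ses E) h n : connecting h ->
  [/\ exact_at (F_Om F O n.+1 (sesg S)) (F_Om F O n h),
      exact_at (F_Om F O n h) (F_Om F O n (sesf S))
    & exact_at (F_Om F O n (sesf S)) (F_Om F O n (sesg S))].
Proof.
move=> lh; have [hH H0] := iterated_syz_half_exact n.
have [f' lf] := syz_lift_ex O (sesf S); have [g' lg] := syz_lift_ex O (sesg S).
have [e1 e2 _] := les_step hH H0 lf lg lh.
rewrite !HE (HS n lg); split=> //; exact/hH/ses_conf.
Qed.

Lemma left_natural (S T : ses E) (a : mor (sesA S) (sesA T))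
    (b : mor (sesB S) (sesB T)) (c : mor (sesC S) (sesC T)) h k n :
  b \oc sesf S = sesf T \oc a -> c \oc sesg S = sesg T \oc b ->
  connecting h -> connecting k ->
  [/\ F_Om F O n a \oc F_Om F O n h = F_Om F O n k \oc F_Om F O n.+1 c,
      F_Om F O n b \oc F_Om F O n (sesf S)
      = F_Om F O n (sesf T) \oc F_Om F O n a
    & F_Om F O n c \oc F_Om F O n (sesg S)
      = F_Om F O n (sesg T) \oc F_Om F O n b].
Proof.
move=> bf cg lh lk; have [hH H0] := iterated_syz_half_exact n.
have [c' lc] := syz_lift_ex O c.
rewrite !HE (HS n lc) -!(fmap_comp (H n)) bf cg; split=> //.
by rewrite !(fmap_comp (H n)); apply: (connecting_natural hH H0 bf cg lh lk lc).
Qed.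

End LeftHalf.

Section RightHalf.
Variables (E : exactCat) (A : preadditive) (F : functor E A) (O : cosyzygies E).
Hypothesis F_half_exact : half_exact F.
Hypothesis F_inj : forall I : E, injective_obj I -> is_zero (F I).

Let H n : functor E A :=
  @iterated E A F (inj_class E) (Omega_co O) F_half_exact F_inj n.

Let HE n (X Y : E) (f : mor X Y) : F_Co F O n f = fmap (H n) f.
Proof. by case: n => [|n] //; rewrite fmap_iterated0. Qed.

Let HS n (X Y : E) (f : mor X Y) f' :
  @cosyz_lift E O X Y f f' -> fmap (H n.+1) f = fmap (H n) f'.
Proof. by move=> lf; apply/fmap_iteratedS/cosyz_mapE. Qed.

Lemma iterated_cosyz_half_exact n :
  half_exact (H n) /\ forall I : E, injective_obj I -> is_zero (H n I).
Proof.
elim: n => [|n [hH H0]]; split=> //.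
- by move=> X Y Z f g fg; rewrite !fmap_iterated0; apply: F_half_exact.
- move=> X Y Z f g fg; pose S := Ses fg.
  have [f' lf] := cosyz_lift_ex O f; have [g' lg] := cosyz_lift_ex O g.
  have [h lh] := co_connecting_ex O S.
  rewrite (HS n lf) (HS n lg).
  by have [_ _] := @co_les_step E A (H n) hH H0 O S f' g' h lf lg lh.
- move=> I II; have [f' lf] := cosyz_lift_ex O (idm I); apply: is_zeroP.
  rewrite -fmap1 (HS n lf); exact: (@fmap_cosyz_lift_inj E A (H n) hH H0 O I).
Qed.

Lemma right_exact_sequence (S : ses E) h n : co_connecting h ->
  [/\ exact_at (F_Co F O n (sesf S)) (F_Co F O n (sesg S)),
      exact_at (F_Co F O n (sesg S)) (F_Co F O n h)
    & exact_at (F_Co F O n h) (F_Co F O n.+1 (sesf S))].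
Proof.
move=> lh; have [hH H0] := iterated_cosyz_half_exact n.
have [f' lf] := cosyz_lift_ex O (sesf S).
have [g' lg] := cosyz_lift_ex O (sesg S).
have [e1 e2 _] := co_les_step hH H0 lf lg lh.
rewrite !HE (HS n lf); split=> //; exact/hH/ses_conf.
Qed.

Lemma right_natural (S T : ses E) (a : mor (sesA S) (sesA T))
    (b : mor (sesB S) (sesB T)) (c : mor (sesC S) (sesC T)) h k n :
  b \oc sesf S = sesf T \oc a -> c \oc sesg S = sesg T \oc b ->
  co_connecting h -> co_connecting k ->
  [/\ F_Co F O n b \oc F_Co F O n (sesf S)
      = F_Co F O n (sesf T) \oc F_Co F O n a,
      F_Co F O n c \oc F_Co F O n (sesg S)
      = F_Co F O n (sesg T) \oc F_Co F O n b
    & F_Co F O n.+1 a \oc F_Co F O n h = F_Co F O n k \oc F_Co F O n c].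
Proof.
move=> bf cg lh lk; have [hH H0] := iterated_cosyz_half_exact n.
have [a' la] := cosyz_lift_ex O a.
rewrite !HE (HS n la) -!(fmap_comp (H n)) bf cg; split=> //.
rewrite !(fmap_comp (H n)).
exact: (co_connecting_natural hH H0 bf cg lh lk la).
Qed.

End RightHalf.

Theorem corollary4p6
  (B : exactCat) (B_KS : krull_schmidt B)
  (B_proj : enough_projectives B) (B_inj : enough_injectives B)
  (O : syzygies B) (O' : cosyzygies B)
  (A : preadditive) (A_abelian : abelian_cat A)
  (F : functor B A) (F_half_exact : half_exact F)
  (F_proj : forall P : B, projective_obj P -> is_zero (F P))
  (F_inj : forall I : B, injective_obj I -> is_zero (F I)) :
  exists (h : forall S : ses B, mor (sesC S) (cosyz O' (sesA S)))
         (h' : forall S : ses B, mor (syz O (sesC S)) (sesA S)),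
    (forall S : ses B, long_exact F (h S) (h' S)) /\
    (forall (S T : ses B) (a : mor (sesA S) (sesA T))
            (b : mor (sesB S) (sesB T)) (c : mor (sesC S) (sesC T)),
       b \oc sesf S = sesf T \oc a -> c \oc sesg S = sesg T \oc b ->
       long_exact_commutes F (h S) (h' S) (h T) (h' T) a b c).
Proof.
pose h S := sval (cid (co_connecting_ex O' S)).
pose h' S := sval (cid (connecting_ex O S)).
have hP S : co_connecting (h S) := svalP (cid (co_connecting_ex O' S)).
have h'P S : connecting (h' S) := svalP (cid (connecting_ex O S)).
exists h, h'; split=> [S|S T a b c bf cg]; split=> n.
- exact: left_exact_sequence.
- exact: right_exact_sequence.
- exact: left_natural.
- exact: right_natural.
Qed.
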